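(* The basis $\{X_\alpha\}$ defined by $X_\alpha = \sum_{\beta \ge \alpha} f(\alpha, \beta) M_\beta$, where \[ f(\alpha) = \begin{cases} f_\mathbb{E}(\alpha|_\mathbb{E}) \frac{1}{\mathrm{odd}(\alpha)!} & \text{if } \alpha = \alpha|_\mathbb{E} \, \alpha|_\mathbb{O}, \\ 0 & \text{otherwise,} \end{cases} \] is an eigenbasis for $\Theta,$ with \[ \Theta(X_\alpha) = \begin{cases} 2^{\ell(\alpha)} X_\alpha & \text{if } \alpha \text{ is odd}, \\ 0 & \text{otherwise.} \end{cases} \]
   Context: Work over a field $\mathbbm{k}$ of characteristic zero. Compositions are finite sequences of positive integers; a composition is odd if all its parts are odd; $\mathrm{odd}(\alpha)$ is its number of odd parts. $\mathbb{E}=\{2,4,6,\dots\}$, $\mathbb{O}=\{1,3,5,\dots\}$, and $\alpha|_C$ is the subsequence of parts of $\alpha$ in $C$. For $\alpha\le\beta$ (i.e. $\alpha=\alpha^{(1)}\cdots\alpha^{(\ell(\beta))}$ with $\alpha^{(i)}$ a composition of $\beta_i$), $f(\alpha,\beta)=\prod_i f(\alpha^{(i)})$. $\{M_\alpha\}$ is the monomial basis of $\mathrm{QSym}$. Here $f_\mathbb{E}$ is any nonsingular shuffle character, i.e. $f_\mathbb{E}(n)\neq0$ for all $n$ and, setting $f_\mathbb{E}(\emptyset)=1$, $f_\mathbb{E}(\alpha)f_\mathbb{E}(\beta)=\sum_{\gamma\in\alpha \sqcup\!\sqcup \beta}f_\mathbb{E}(\gamma)$, where $\alpha \sqcup\!\sqcup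 \beta$ is the multiset of compositions of length $\ell(\alpha)+\ell(\beta)$ containing $\alpha,\beta$ as disjoint subsequences, with multiplicity (so that $\{X_\alpha\}$ is a shuffle basis). Let $\zeta_Q$ be the character of $\mathrm{QSym}$ with $\zeta_Q(F)=F(1,0,0,\dots)$, $\overline{\zeta}_Q(M_\alpha)=(-1)^{|\alpha|}\zeta_Q(M_\alpha)$, and $\nu_Q=\overline{\zeta}_Q^{-1}*\zeta_Q$ (convolution). $\Theta\colon\mathrm{QSym}\to\mathrm{QSym}$ is the unique Hopf map with $\zeta_Q\circ\Theta=\nu_Q$ (morphism of combinatorial Hopf algebras $(\mathrm{QSym},\nu_Q)\to(\mathrm{QSym},\zeta_Q)$). *)

(* Defs.v *)
From HB Require Import structures.
From mathcomp Require Import all_boot all_order all_algebra.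
From mathcomp Require Import finmap ring.
From mathcomp.multinomials Require Export monalg.

Set Implicit Arguments.
Unset Strict Implicit.
Unset Printing Implicit Defensive.

Import GRing.Theory.
Local Open Scope ring_scope.

(** * Compositions *)

Definition part := {n : nat | (0 < n)%N}.
Definition composition := seq part.

Definition padd (m n : part) : part := exist _ (val m + val n)%N (ltn_addr _ (valP m)).

Definition csize (a : composition) : nat := (\sum_(p <- a) val p)%N.

(* The size of [a] as a part; the value [1] on the empty composition is junk
   and is never used. *)
Definition cpart (a : composition) : part := insubd (exist _ 1%N isT) (csize a).

Definition odd_part : pred part := fun p => odd (val p).
Definition even_part : pred part := fun p => ~~ odd (val p).

(* [cuts a] lists the sequences [bs] of nonempty compositions whose
   concatenation is [a] (see [mem_cuts] and [cuts_uniq]). *)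
Fixpoint cuts (a : composition) : seq (seq composition) :=
  if a isn't p :: a' then [:: [::]] else
  flatten [seq ([:: p] :: bs) ::
               (if bs is b :: bs' then [:: (p :: b) :: bs'] else [::])
          | bs <- cuts a'].

(* The compositions [b >= a], i.e. the coarsenings of [a], listed once each. *)
Definition coarsenings (a : composition) : seq composition :=
  [seq map cpart bs | bs <- cuts a].

Lemma mem_cuts a bs :
  (bs \in cuts a) = (flatten bs == a) && all (fun b : composition => b != [::]) bs.
Proof.
elim: a bs => [|p a IH] bs.
  by case: bs => [|[|q b] bs] //=; rewrite ?andbF // inE.
apply/flatten_mapP/idP => [[cs]|].
  rewrite IH => /andP[/eqP <- ne]; rewrite inE => /orP[/eqP -> /=|]; first by rewrite eqxx.
  by case: cs ne => [//|c cs] /= /andP[_ ne]; rewrite inE => /eqP -> /=; rewrite eqxx.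
case: bs => [//|[|q [|r b]] bs] //=; first by rewrite andbF.
  case/andP=> /eqP[-> e] ne; exists bs; first by rewrite IH e eqxx.
  by rewrite inE eqxx.
case/andP=> /eqP[-> e] ne; exists ((r :: b) :: bs); first by rewrite IH /= e eqxx.
by rewrite !inE eqxx orbT.
Qed.

Lemma cuts_uniq a : uniq (cuts a).
Proof.
pose ne := all (fun b : composition => b != [::]).
elim: a => [//|p a IH] /=.
pose ext (bs : seq composition) : seq (seq composition) :=
  ([:: p] :: bs) :: (if bs is b :: bs' then [:: (p :: b) :: bs'] else [::]).
have extI bs cs ds : ne bs -> ne cs -> ds \in ext bs -> ds \in ext cs -> bs = cs.
  move=> nbs ncs; rewrite !inE => /orP[/eqP ->|].
    case/orP => [/eqP[] //|].
    by case: cs ncs => [//|[|c1 c] cs] //= _; rewrite inE => /eqP[].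
  case: bs nbs => [//|[|b1 b] bs] //= _; rewrite inE => /eqP ->.
  case/orP => [/eqP[] //|].
  by case: cs ncs => [//|c cs] //= _; rewrite inE => /eqP[-> ->].
have ext_uniq bs : ne bs -> uniq (ext bs).
  by case: bs => [|[|b1 b] bs] //= _; rewrite inE andbT; apply/eqP.
have : {in cuts a, forall bs, ne bs} by move=> bs; rewrite mem_cuts => /andP[].
rewrite -/ext; move: (cuts a) IH.
elim=> [//|bs l IHl] /= /andP[nin ul] nel.
change (uniq (ext bs ++ flatten (map ext l))).
rewrite cat_uniq ext_uniq ?nel ?mem_head //=.
rewrite IHl ?andbT //; last by move=> cs cl; apply: nel; rewrite inE cl orbT.
apply/hasPn => ds /flatten_mapP[cs cl] dcs.
apply: contra nin => dbs.
by rewrite (extI bs cs ds) //; apply: nel; rewrite inE ?eqxx ?cl ?orbT.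
Qed.

Lemma csize_cons p a : csize (p :: a) = (val p + csize a)%N.
Proof. by rewrite /csize big_cons. Qed.

Lemma csize_eq0 a : (csize a == 0%N) = (a == [::]).
Proof.
by case: a => [|p a]; [rewrite /csize big_nil | rewrite csize_cons addn_eq0 eqn0Ngt (valP p)].
Qed.

Lemma val_cpart a : a != [::] -> val (cpart a) = csize a.
Proof. by rewrite -csize_eq0 -lt0n => a_gt0; rewrite /cpart insubdK. Qed.

Lemma map_cpart_inj a : {in cuts a &, injective (map cpart)}.
Proof.
move=> bs cs; rewrite !mem_cuts => /andP[/eqP <- nbs] /andP[/eqP e ncs] {a}.
elim: bs cs e nbs ncs => [|b bs IH] [|c cs] //= e /andP[nb nbs] /andP[nc ncs] [ebc ebcs].
move: ebc; rewrite -!/(csize _) => /(congr1 val); rewrite !val_cpart // => ebc.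
suff [ebc' e'] : b = c /\ flatten cs = flatten bs by rewrite -ebc' (IH cs).
have csize0 : csize [::] = 0%N by rewrite /csize big_nil.
elim: b c ebc e {nb nc} => [|p b IHb] [|q c] //.
- by rewrite csize0 => /esym/eqP; rewrite csize_eq0.
- by rewrite csize0 => /eqP; rewrite csize_eq0.
rewrite !csize_cons /= => + [eqp e]; rewrite eqp => /addnI ebc.
by case: (IHb c ebc e) => -> ->.
Qed.

Lemma coarsenings_uniq a : uniq (coarsenings a).
Proof. by rewrite map_inj_in_uniq ?cuts_uniq //; apply: map_cpart_inj. Qed.

(* The multiset of shuffles of two compositions. *)
Fixpoint shuffle (a b : composition) {struct a} : seq composition :=
  let fix shuffle_a (b : composition) : seq composition :=
    match a, b with
    | [::], _ => [:: b]
    | _, [::] => [:: a]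
    | p :: a', q :: b' =>
        [seq p :: c | c <- shuffle a' b] ++ [seq q :: c | c <- shuffle_a b']
    end in
  shuffle_a b.

(* The multiset of quasi-shuffles (overlapping shuffles). *)
Fixpoint qshuffle (a b : composition) {struct a} : seq composition :=
  let fix qshuffle_a (b : composition) : seq composition :=
    match a, b with
    | [::], _ => [:: b]
    | _, [::] => [:: a]
    | p :: a', q :: b' =>
        [seq p :: c | c <- qshuffle a' b] ++ [seq q :: c | c <- qshuffle_a b']
        ++ [seq padd p q :: c | c <- qshuffle a' b']
    end in
  qshuffle_a b.

(** * The Hopf algebra QSym *)

(* Elements are finite linear combinations of the monomial basis [QM a]; the
   tensor square is the free module on the tensors of basis elements.  The
   ring structure that [monalg] puts on [{malg k[G]}] for a monoid [G] plays no
   role here: the product of QSym is [qmul]. *)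
Notation QSym k := {malg k[composition]}.
Notation QSym2 k := {malg k[(composition * composition)%type]}.

Definition QM {k : fieldType} (a : composition) : QSym k := mkmalgU a 1.

(* The linear map with values [h] on the basis. *)
Definition linext (k : fieldType) (K : choiceType) (V : lmodType k) (h : K -> V)
    (F : {malg k[K]}) : V :=
  \sum_(a <- msupp F) mcoeff a F *: h a.

Section Linext.
Variables (k : fieldType) (K : choiceType) (V : lmodType k) (h : K -> V).

Lemma linextEw (d : {fset K}) (F : {malg k[K]}) :
  (msupp F `<=` d)%fset -> linext h F = \sum_(a <- d) mcoeff a F *: h a.
Proof.
move=> le; rewrite /linext (big_fset_incl _ le) //= => a _ /mcoeff_outdom ->.
by rewrite scale0r.
Qed.

Lemma linext_is_linear : linear (linext h).
Proof.
move=> c F G; pose d := (msupp F `|` msupp G `|` msupp (c *: F + G))%fset.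
have sub E : E \in [:: F; G; c *: F + G] -> (msupp E `<=` d)%fset.
  by rewrite !inE => /or3P[] /eqP ->; apply/fsubsetP => a aE; rewrite !inE aE ?orbT.
rewrite !(@linextEw d) ?sub ?inE ?eqxx ?orbT //.
rewrite scaler_sumr -big_split /=; apply: eq_bigr => a _.
by rewrite mcoeffD mcoeffZ scalerDl scalerA.
Qed.

HB.instance Definition _ :=
  GRing.isLinear.Build k {malg k[K]} V *:%R (linext h) linext_is_linear.

Lemma linextU a : linext h (mkmalgU a 1) = h a.
Proof.
rewrite /linext msuppU oner_eq0 big_seq_fset1.
by rewrite mcoeffUU scale1r.
Qed.

Lemma linext_sumU (s : seq K) :
  linext h (\sum_(a <- s) mkmalgU a 1) = \sum_(a <- s) h a.
Proof.
by rewrite (linear_sum (linext h)); apply: eq_bigr => a _; apply: linextU.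
Qed.

Lemma linext_comp (W : lmodType k) (T : {linear V -> W}) (F : {malg k[K]}) :
  T (linext h F) = linext (fun a => T (h a)) F.
Proof. by rewrite /linext linear_sum; apply: eq_bigr => a _; rewrite linearZ. Qed.

End Linext.

Lemma eq_linext (k : fieldType) (K : choiceType) (V : lmodType k) (h h' : K -> V) :
  h =1 h' -> linext h =1 linext h'.
Proof. by move=> e F; apply: eq_bigr => a _; rewrite e. Qed.

Section Hopf.
Context {k : fieldType}.
Implicit Types (a b : composition) (F G : QSym k) (phi psi : QSym k -> k).

(* In terms of values of quasisymmetric functions, [qmul] is the pointwise
   product ([qeval_mul]) and [coproduct] splits the ordered alphabet in two
   ([qeval_cat]). *)
Definition qmul F G : QSym k :=
  linext (fun a => linext (fun b => \sum_(c <- qshuffle a b) QM c) G) F.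

Definition tensor F G : QSym2 k :=
  linext (fun a => linext (fun b => mkmalgU (a, b) 1) G) F.

Definition coproduct : QSym k -> QSym2 k :=
  linext (fun a => \sum_(i < (size a).+1) tensor (QM (take i a)) (QM (drop i a))).

Definition counit F : k := mcoeff [::] F.

Definition tensor_map (T : QSym k -> QSym k) : QSym2 k -> QSym2 k :=
  linext (fun ab => tensor (T (QM ab.1)) (T (QM ab.2))).

Definition homogeneous (n : nat) F : Prop :=
  forall a, mcoeff a F != 0 -> csize a = n.

(* A morphism of graded bialgebras; compatibility with the antipodes is then
   automatic. *)
Definition hopf_map (T : {linear QSym k -> QSym k}) : Prop :=
  [/\ T (QM [::]) = QM [::],
      forall F G, T (qmul F G) = qmul (T F) (T G),
      forall F, counit (T F) = counit F,
      forall F, coproduct (T F) = tensor_map T (coproduct F)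
    & forall n F, homogeneous n F -> homogeneous n (T F)].

(** ** Evaluation *)

(* The value of
     M_(a_1, ..., a_l) = \sum_(i_1 < ... < i_l) x_(i_1)^a_1 ... x_(i_l)^a_l
   at (x_1, ..., x_n, 0, 0, ...): either i_1 = 1 or i_1 > 1. *)
Fixpoint meval (a : composition) (xs : seq k) {struct xs} : k :=
  match a, xs with
  | [::], _ => 1
  | _ :: _, [::] => 0
  | p :: a', x :: xs' => x ^+ val p * meval a' xs' + meval a xs'
  end.

Definition qeval (xs : seq k) (F : QSym k) : k :=
  linext (fun a => meval a xs : k^o) F.

Lemma meval_mul a b (xs : seq k) :
  meval a xs * meval b xs = \sum_(c <- qshuffle a b) meval c xs.
Proof.
have nill (c : composition) : qshuffle [::] c = [:: c] by case: c.
have nilr (c : composition) : qshuffle c [::] = [:: c] by case: c.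
elim: xs a b => [|x xs IH] [|p a] [|q b]; rewrite ?nill ?nilr ?big_seq1 ?mul1r ?mulr1 //=.
  by rewrite mul0r !big_cat !big_map /= !big1 ?addr0.
rewrite !big_cat !big_map /= !big_split /= -!mulr_sumr.
have -> : \sum_(c <- (fix qshuffle_a (b : composition) : seq composition :=
    match b with
    | [::] => [:: p :: a]
    | q :: b' => [seq p :: c | c <- qshuffle a b] ++ [seq q :: c | c <- qshuffle_a b']
                 ++ [seq padd p q :: c | c <- qshuffle a b']
    end) b) meval c xs = meval (p :: a) xs * meval b xs by rewrite IH.
rewrite -!IH exprD.
have := IH (p :: a) (q :: b); rewrite /= !big_cat !big_map /= => e.
rewrite mulrDl !mulrDr e; ring.
Qed.

Lemma qeval_mul (xs : seq k) F G : qeval xs (qmul F G) = qeval xs F * qeval xs G.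
Proof.
rewrite /qeval /qmul linext_comp.
transitivity (linext (fun a => meval a xs * linext (fun b => meval b xs : k^o) G : k^o) F).
  apply: (@eq_linext k _ k^o) => a; rewrite linext_comp {2}/linext mulr_sumr.
  apply: eq_bigr => b _.
  transitivity (mcoeff b G * (meval a xs * meval b xs)); last by rewrite mulrCA.
  by rewrite meval_mul -(@linext_sumU k _ k^o (fun c => meval c xs)).
rewrite /linext mulr_suml; apply: eq_bigr => a _; exact: mulrA.
Qed.

(** ** Characters *)

Definition conv phi psi (F : QSym k) : k :=
  linext (fun ab => phi (QM ab.1) * psi (QM ab.2) : k^o) (coproduct F).

(* The convolution inverse of a functional with value 1 at 1, expanded as the
   geometric series of [counit - phi] (see [conv_invl] and [conv_invr]). *)
Definition conv_inv phi (F : QSym k) : k :=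
  linext (fun a => \sum_(bs <- cuts a) \prod_(b <- bs) - phi (QM b) : k^o) F.

Lemma tensorM a b : tensor (QM a) (QM b) = mkmalgU (a, b) 1.
Proof. by rewrite /tensor /QM !linextU. Qed.

Lemma convM phi psi a :
  conv phi psi (QM a) =
  \sum_(i < (size a).+1) phi (QM (take i a)) * psi (QM (drop i a)).
Proof.
rewrite /conv /coproduct linextU; set h := fun ab => _.
rewrite (linear_sum (@linext k _ k^o h)); apply: eq_bigr => i _.
by rewrite tensorM; apply: (@linextU k _ k^o).
Qed.

Lemma conv_ext phi psi (h : composition -> k^o) :
  (forall a, \sum_(i < (size a).+1) phi (QM (take i a)) * psi (QM (drop i a)) = h a) ->
  conv phi psi =1 linext h.
Proof.
move=> e F; rewrite /conv /coproduct (linext_comp _ _ F).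
by apply: (@eq_linext k _ k^o) => a; rewrite -e -convM /conv /coproduct linextU.
Qed.

Lemma counitE F : counit F = linext (fun a => (a == [::])%:R : k^o) F.
Proof.
rewrite /counit {1}(monalgE F) raddf_sum; apply: eq_bigr => a _.
by rewrite /= mcoeffU -[LHS]mulr_natr.
Qed.

Lemma qeval_cat (xs ys : seq k) : qeval (xs ++ ys) =1 conv (qeval xs) (qeval ys).
Proof.
have qevalM zs a : qeval zs (QM a) = meval a zs by exact: (@linextU k _ k^o).
have m0 zs : meval [::] zs = 1 by case: zs.
move=> F; apply/esym; move: F; apply: conv_ext => a.
under eq_bigr do rewrite !qevalM.
elim: xs a => [|x xs IH] a.
  rewrite big_ord_recl take0 drop0 mul1r big1 ?addr0 // => i _.
  by case: a i => [[]|p a i] //=; rewrite mul0r.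
case: a => [|p a]; first by rewrite big_ord1 /= mul1r m0.
rewrite big_ord_recl /= -!IH [X in _ = _ + X]big_ord_recl /= m0 mulr_sumr.
rewrite addrCA; congr (_ + _); rewrite -big_split; apply: eq_bigr => i _ /=.
by rewrite mulrDl mulrA.
Qed.

(* Splitting off the first block. *)
Lemma sum_cuts_cons (h : composition -> k) p a :
  \sum_(bs <- cuts (p :: a)) \prod_(b <- bs) h b =
  \sum_(i < (size a).+1)
     h (p :: take i a) * \sum_(bs <- cuts (drop i a)) \prod_(b <- bs) h b.
Proof.
have gen (g : composition -> k) q c :
    \sum_(bs <- cuts (q :: c)) g (head [::] bs) * \prod_(b <- behead bs) h b =
    \sum_(i < (size c).+1)
       g (q :: take i c) * \sum_(bs <- cuts (drop i c)) \prod_(b <- bs) h b.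
  elim: c q g => [|r c IH] q g.
    by rewrite big_ord1 /= !big_seq1.
  rewrite [cuts _]/= -/(cuts (r :: c)) big_flatten big_map big_ord_recl.
  rewrite take0 drop0 mulr_sumr -(IH r (fun b => g (q :: b))) -big_split.
  rewrite big_seq [RHS]big_seq; apply: eq_bigr => bs.
  by rewrite mem_cuts; case: bs => [//|b bs] _; rewrite big_cons big_seq1.
rewrite -gen big_seq [RHS]big_seq; apply: eq_bigr => bs.
by rewrite mem_cuts; case: bs => [//|b bs] _; rewrite big_cons.
Qed.

Lemma conv_invM phi a :
  conv_inv phi (QM a) = \sum_(bs <- cuts a) \prod_(b <- bs) - phi (QM b).
Proof. exact: (@linextU k _ k^o). Qed.

Lemma conv_inv0 phi : conv_inv phi (QM [::]) = 1.
Proof. by rewrite conv_invM big_seq1 big_nil. Qed.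

Lemma conv_inv_cons phi p a :
  conv_inv phi (QM (p :: a)) =
  - \sum_(i < (size a).+1) phi (QM (p :: take i a)) * conv_inv phi (QM (drop i a)).
Proof.
rewrite conv_invM (sum_cuts_cons (fun b => - phi (QM b))) -sumrN.
by apply: eq_bigr => i _; rewrite conv_invM mulNr.
Qed.

Lemma conv_invr phi : phi (QM [::]) = 1 -> conv phi (conv_inv phi) =1 counit.
Proof.
move=> phi1 F; rewrite counitE; move: F; apply: conv_ext => -[|p a].
  by rewrite big_ord1 phi1 conv_inv0 mulr1.
by rewrite big_ord_recl take0 drop0 phi1 mul1r conv_inv_cons addNr.
Qed.

Lemma conv_invl phi : phi (QM [::]) = 1 -> conv (conv_inv phi) phi =1 counit.
Proof.
move=> phi1 F; rewrite counitE; move: F; apply: conv_ext => a.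
have [n] := ubnP (size a); elim: n a => // n IH [|p a] /= lt_an.
  by rewrite big_ord1 phi1 conv_inv0 mulr1.
rewrite big_ord_recl take0 drop0 conv_inv0 mul1r.
pose D i := \sum_(j < (size (drop i a)).+1)
  conv_inv phi (QM (take j (drop i a))) * phi (QM (drop j (drop i a))).
suff -> : \sum_(i < (size a).+1)
    conv_inv phi (QM (p :: take i a)) * phi (QM (drop i a)) =
    - \sum_(i < (size a).+1) phi (QM (p :: take i a)) * D i.
  rewrite big_ord_recr /= big1 => [|i _]; last first.
    rewrite /D IH ?size_drop; last by rewrite (leq_ltn_trans (leq_subr _ _)).
    rewrite -size_eq0 size_drop subn_eq0 leqNgt ltn_ord mulr0 //.
  by rewrite /D drop_size take_size big_ord1 conv_inv0 phi1 !mulr1 add0r subrr.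
under eq_bigr do rewrite conv_inv_cons mulNr mulr_suml.
rewrite sumrN; congr (- _).
under [RHS]eq_bigr do rewrite /D mulr_sumr.
pose t j i := phi (QM (p :: take j a)) *
  (conv_inv phi (QM (take (i - j) (drop j a))) * phi (QM (drop i a))).
transitivity (\sum_(i < (size a).+1) \sum_(j < (size a).+1 | (j < i.+1)%N) t j i).
  apply: eq_bigr => -[i lt_i] _ /=.
  rewrite (size_takel lt_i) -(big_ord_widen _ (fun j => t j i)) //.
  apply: eq_bigr => -[j le_ji] _ /=.
  by rewrite /t take_takel // -mulrA take_drop subnK.
rewrite (exchange_big_dep xpredT) //=; apply: eq_bigr => -[j lt_j] _ /=.
rewrite size_drop -subSn // -(big_mkord xpredT (fun l => phi (QM (p :: take j a)) *
  (conv_inv phi (QM (take l (drop j a))) * phi (QM (drop l (drop j a)))))).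
rewrite -(big_mkord (fun i => (j < i.+1)%N) (t j)).
rewrite (@big_cat_nat _ _ _ j) //=; last exact: ltnW.
rewrite big_nat_cond big_pred0 ?add0r; last first.
  by move=> i; apply/negP => /andP[/andP[_ lt_ij]]; rewrite ltnS leqNgt lt_ij.
rewrite -{1}[j]add0n big_addn big_nat_cond [RHS]big_nat_cond.
apply: eq_big => [i|i _]; first by rewrite ltnS leq_addl.
by rewrite /t addnK drop_drop.
Qed.

Definition zetaQ : QSym k -> k := qeval [:: 1].

Definition zetaQ_bar (F : QSym k) : k :=
  linext (fun a => (-1) ^+ csize a * zetaQ (QM a) : k^o) F.

Lemma zetaQM a : zetaQ (QM a) = (size a <= 1)%N%:R.
Proof.
rewrite /zetaQ /qeval; transitivity (meval a [:: 1]); first exact: (@linextU k _ k^o).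
by case: a => [|p [|q a]] //=; rewrite ?expr1n ?mulr1 ?mulr0 addr0.
Qed.

Lemma zetaQ_barM a : zetaQ_bar (QM a) = (-1) ^+ csize a * zetaQ (QM a).
Proof. exact: (@linextU k _ k^o). Qed.

Definition nuQ : QSym k -> k := conv (conv_inv zetaQ_bar) zetaQ.

(** ** Bases *)

(* Every element is a finite linear combination of the family in exactly one
   way. *)
Definition is_basis (X : composition -> QSym k) : Prop :=
  forall F, exists! c : {malg k[composition]}, F = linext X c.

Definition is_eigenbasis (T : QSym k -> QSym k) (X : composition -> QSym k) : Prop :=
  is_basis X /\ forall a, exists c : k, T (X a) = c *: X a.

(* [f (a, b)], the product of the [f (a^(i))], for [a <= b]; the sum has exactly
   one term (see [map_cpart_inj]). *)
Definition frefine (f : composition -> k) a b : k :=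
  \sum_(bs <- cuts a | map cpart bs == b) \prod_(c <- bs) f c.

Definition Xelt (f : composition -> k) a : QSym k :=
  \sum_(b <- coarsenings a) frefine f a b *: QM b.

(* Shuffle characters on the compositions with all parts in [C]; the values of
   [g] elsewhere are irrelevant. *)
Definition nonsingular_shuffle_character (C : pred part) (g : composition -> k) : Prop :=
  [/\ g [::] = 1,
      forall n, C n -> g [:: n] != 0
    & forall a b, all C a -> all C b ->
        g a * g b = \sum_(c <- shuffle a b) g c].

Definition f_of (fE : composition -> k) a : k :=
  if a == filter even_part a ++ filter odd_part a
  then fE (filter even_part a) * ((count odd_part a)`!%:R)^-1
  else 0.

End Hopf.

(* Main.v *)
(* A graded coalgebra endomorphism T of QSym is determined by the functional
   zeta_Q o T: reading the coefficient of M_(p, b) in T(F) off the tensor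
   M_(p) (x) M_b in the coproduct of T(F) recovers it from zeta_Q o T and from
   the coefficients of M_b.  The map M_a |-> X_a respects coproducts, so
   Theta(X_a) = c_a X_a with c_a = 2^l(a) for odd a and 0 otherwise follows from
   nu_Q(X_a) = c_a f(a).  Writing f^-(a) = (-1)^|a| f(a), the functional
   a |-> nu_Q(X_a) is the unique h with f^- * h = f, and a |-> c_a f(a) satisfies
   this equation because, on odd parts, it reads
   \sum_i (-1)^i / i! * 2^(n-i) / (n-i)! = (2 - 1)^n / n!.
   The X_a form a basis by triangularity with respect to length. *)
Require Import Defs.
From mathcomp Require Import all_boot all_order all_algebra.
From mathcomp Require Import finmap ring.

Import GRing.Theory.
Local Open Scope ring_scope.

(** * Sums over the cuts of a composition *)

Lemma sum_cuts_letter (V : nmodType) (H : seq composition -> V) p a :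
  \sum_(bs <- cuts (p :: a)) H bs =
  \sum_(bs <- cuts a)
    (H ([:: p] :: bs) + (if bs is b :: bs' then H ((p :: b) :: bs') else 0)).
Proof.
rewrite /= big_flatten big_map; apply: eq_bigr => -[|b bs] _.
  by rewrite big_seq1 addr0.
by rewrite big_cons big_seq1.
Qed.

Lemma sum_cuts_first (V : nmodType) (H : seq composition -> V) p a :
  \sum_(bs <- cuts (p :: a)) H bs =
  \sum_(i < (size a).+1)
    \sum_(bs <- cuts (drop i a)) H ((p :: take i a) :: bs).
Proof.
elim: a p H => [|r a IH] p H; first by rewrite big_ord1 !big_seq1.
rewrite sum_cuts_letter big_split big_ord_recl take0 drop0 /=; congr (_ + _).
by rewrite -/(cuts (r :: a)) IH.
Qed.

(* Cutting a list of blocks in two amounts to cutting the composition at a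
   block boundary. *)
Lemma sum_cuts_split (V : nmodType)
    (G : seq composition -> seq composition -> V) a :
  \sum_(bs <- cuts a) \sum_(i < (size bs).+1) G (take i bs) (drop i bs) =
  \sum_(j < (size a).+1)
    \sum_(bs <- cuts (take j a)) \sum_(cs <- cuts (drop j a)) G bs cs.
Proof.
elim: a G => [|p a IH] G; first by rewrite !(big_ord1, big_seq1).
(* [G'] collects the ways of obtaining a nonempty left factor by prepending [p]; the terms with
   empty left factor are matched separately. *)
pose G' bs cs := G ([:: p] :: bs) cs +
  (if bs is b :: bs' then G ((p :: b) :: bs') cs else 0).
rewrite [RHS]big_ord_recl /= -/(cuts (p :: a)) big_seq1 !sum_cuts_letter.
transitivity (\sum_(bs <- cuts a) (G [::] ([:: p] :: bs) +
    (if bs is b :: bs' then G [::] ((p :: b) :: bs') else 0)) +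
  \sum_(bs <- cuts a) \sum_(i < (size bs).+1) G' (take i bs) (drop i bs)).
  rewrite -big_split; apply: eq_bigr => bs _ /=.
  rewrite big_ord_recl /= -addrA -[RHS]addrA; congr (_ + _).
  case: bs => [|b bs]; first by rewrite !big_ord1 /G' /= !addr0 add0r.
  rewrite big_split addrCA; congr (_ + _) => /=.
  by rewrite big_ord_recl [X in _ = _ + X]big_ord_recl /= add0r.
congr (_ + _); rewrite IH; apply: eq_bigr => j _.
rewrite -/(cuts (p :: take j a)) sum_cuts_letter; apply: eq_bigr => bs _.
case: bs => [|b bs] /=; last by rewrite -big_split.
by rewrite addr0; apply: eq_bigr => cs _; rewrite /G' addr0.
Qed.

Definition singletons (a : composition) : seq composition := [seq [:: p] | p <- a].

(** Isolates the finest cut, the source of the leading term in [Xelt_triangular]. *)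
Lemma cuts_singletons a : exists2 r, cuts a = singletons a :: r &
  forall bs, bs \in r -> (size bs < size a)%N.
Proof.
elim: a => [|p a [r e lt]]; first by exists [::].
rewrite /= e /=; eexists; first by [].
move=> bs; rewrite mem_cat => /orP[|].
  case: (a) => [//|q a'] /=; rewrite inE => /eqP -> /=.
  by rewrite size_map.
case/flatten_mapP=> cs /lt lcs; rewrite inE => /orP[/eqP -> //|].
case: cs lcs => [//|c cs] /= lcs; rewrite inE => /eqP -> /=; exact: ltnW.
Qed.

Lemma map_cpart_singletons a : map cpart (singletons a) = a.
Proof.
rewrite -map_comp -[RHS]map_id; apply: eq_map => p /=; apply: val_inj.
by rewrite val_cpart // /csize big_seq1.
Qed.

Lemma csize_cuts a bs : bs \in cuts a -> csize (map cpart bs) = csize a.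
Proof.
rewrite mem_cuts => /andP[/eqP <-]; elim: bs => [//|b bs IH] /= /andP[nb nbs].
by rewrite csize_cons val_cpart // IH // /csize big_cat.
Qed.

(** * Coefficients of tensors, coproducts and homogeneous elements *)

Section Coefficients.
Context {k : fieldType}.

Lemma mcoeff_linext (K L : choiceType) (h : K -> {malg k[L]}) (F : {malg k[K]}) b :
  mcoeff b (linext h F) = \sum_(a <- msupp F) mcoeff a F * mcoeff b (h a).
Proof. by rewrite /linext raddf_sum; apply: eq_bigr => a _; rewrite /= mcoeffZ. Qed.

Lemma mcoeff_QM a b : mcoeff b (QM a : QSym k) = (a == b)%:R.
Proof. by rewrite mcoeffU. Qed.

Lemma linext_QM (F : QSym k) : linext QM F = F.
Proof.
apply/malgP => b; rewrite mcoeff_linext {3}(monalgE F) raddf_sum.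
by apply: eq_bigr => a _; rewrite /= mcoeff_QM mcoeffU mulr_natr.
Qed.

Lemma mcoeff_tensor (F G : QSym k) b c :
  mcoeff (b, c) (tensor F G) = mcoeff b F * mcoeff c G.
Proof.
rewrite -{2}(linext_QM F) -{2}(linext_QM G) !mcoeff_linext mulr_suml.
apply: eq_bigr => a _; rewrite mcoeff_linext -mulrA; congr (_ * _).
rewrite mulr_sumr; apply: eq_bigr => a' _.
rewrite mcoeffU !mcoeff_QM mulrCA -natrM mulnb.
by congr (_ * _); congr ((_ _)%:R).
Qed.

(** Only the composition [b ++ c], split at position [size b], produces the pair [(b, c)]. *)
Lemma mcoeff_coproduct (F : QSym k) b c :
  mcoeff (b, c) (coproduct F) = mcoeff (b ++ c) F.
Proof.
rewrite -{2}(linext_QM F) !mcoeff_linext; apply: eq_bigr => a _; congr (_ * _).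
rewrite raddf_sum mcoeff_QM /=.
under eq_bigr do rewrite mcoeff_tensor !mcoeff_QM -natrM mulnb.
case: eqVneq => [->|ne].
  have lt_b : (size b < (size (b ++ c)).+1)%N by rewrite ltnS size_cat leq_addr.
  rewrite (bigD1 (Ordinal lt_b)) //= take_size_cat // drop_size_cat // !eqxx.
  rewrite big1 ?addr0 // => i; apply: contraNeq.
  have [eb _|] := eqVneq (take i (b ++ c)) b; last by rewrite eqxx.
  apply/eqP/val_inj; rewrite /= -[in RHS]eb size_take; case: ltnP => // le.
  by apply/eqP; rewrite eqn_leq le -ltnS ltn_ord.
apply: big1 => i _; case: eqVneq => //= e1; case: eqVneq => //= e2.
by move: ne; rewrite -e1 -e2 cat_take_drop eqxx.
Qed.

Lemma zetaQE (F : QSym k) :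
  zetaQ F = \sum_(a <- msupp F) mcoeff a F * (size a <= 1)%N%:R.
Proof.
apply: eq_bigr => a _; congr (_ * _); rewrite -zetaQM.
exact/esym/(@linextU k _ k^o).
Qed.

(** [zetaQ] adds up the coefficients at compositions of length at most one; in degree [val p > 0],
    homogeneity leaves only [[:: p]]. *)
Lemma mcoeff_homogeneous n (F : QSym k) p : homogeneous n F ->
  mcoeff [:: p] F = if n == val p then zetaQ F else 0.
Proof.
have csize1 q : csize [:: q] = val q by rewrite /csize big_seq1.
move=> hF; case: eqVneq => [en|]; last first.
  by apply: contraNeq => /hF; rewrite csize1 => ->.
have uniq1 a : mcoeff a F != 0 -> (size a <= 1)%N -> a = [:: p].
  move=> /hF; rewrite en; case: a => [|q [|//]].
    by rewrite /csize big_nil => e; have := valP p; rewrite -e.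
  by rewrite csize1 => /val_inj ->.
rewrite zetaQE; have [p_in|p_out] := boolP ([:: p] \in msupp F).
  rewrite (big_fsetD1 _ p_in) /= mulr1 big1_seq ?addr0 // => a /andP[_].
  rewrite !inE => /andP[ne a_in]; case: leqP => [le1|]; last by rewrite mulr0.
  by move: ne; rewrite (uniq1 a) ?eqxx // mcoeff_neq0.
rewrite (mcoeff_outdom p_out) big1_seq // => a /andP[_ a_in].
case: leqP => [le1|]; last by rewrite mulr0.
by move: p_out; rewrite -(uniq1 a) ?a_in // mcoeff_neq0.
Qed.

End Coefficients.

(** * Expansion of X_a over cuts, and its coproduct *)

Section Coalgebra.
Context {k : fieldType}.
Implicit Types (f : composition -> k) (a b : composition).

(** Since [map cpart] is injective on [cuts a], each [frefine] sum reduces to one term. *)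
Lemma XeltE f a :
  Xelt f a = \sum_(bs <- cuts a) (\prod_(c <- bs) f c) *: QM (map cpart bs).
Proof.
rewrite /Xelt big_map big_seq [RHS]big_seq; apply: eq_bigr => bs bs_in.
congr (_ *: _); rewrite /frefine big_mkcond (bigD1_seq bs) ?cuts_uniq //= eqxx.
rewrite [X in _ + X]big_seq_cond [X in _ + X]big1 ?addr0 // => cs /andP[cs_in ne].
by case: eqP => // /(map_cpart_inj cs_in bs_in) e; rewrite e eqxx in ne.
Qed.

Lemma Xelt_nil f : Xelt f [::] = QM [::].
Proof. by rewrite XeltE big_seq1 big_nil scale1r. Qed.

Lemma homogeneous_Xelt f a : homogeneous (csize a) (Xelt f a).
Proof.
move=> b; apply: contraNeq => ne; rewrite XeltE raddf_sum big_seq big1 // => bs.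
move=> /csize_cuts e; rewrite /= mcoeffZ mcoeff_QM.
by case: eqVneq => [eb|]; [rewrite -eb e eqxx in ne | rewrite mulr0].
Qed.

Lemma mcoeff_nil_Xelt f a : mcoeff [::] (Xelt f a) = (a == [::])%:R.
Proof.
case: a => [|p a]; first by rewrite Xelt_nil mcoeff_QM.
have [//|/homogeneous_Xelt/eqP] := eqVneq (mcoeff [::] (Xelt f (p :: a))) 0.
by rewrite /csize big_nil eq_sym csize_eq0.
Qed.

Lemma functional_Xelt_cons (phi : {linear QSym k -> k^o}) f p a :
  phi (Xelt f (p :: a)) =
  \sum_(i < (size a).+1) f (p :: take i a) *
    \sum_(bs <- cuts (drop i a)) (\prod_(c <- bs) f c) *
      phi (QM (cpart (p :: take i a) :: map cpart bs)).
Proof.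
rewrite XeltE linear_sum sum_cuts_first; apply: eq_bigr => i _.
rewrite mulr_sumr; apply: eq_bigr => bs _.
by rewrite linearZ big_cons; exact/esym/mulrA.
Qed.

(** The weights are multiplicative over blocks, so deconcatenating the monomials of X_a amounts to
    deconcatenating [a] ([sum_cuts_split]). Stating this after a coalgebra map [T] serves both
    [Theta] and the identity. *)
Lemma mcoeff_cat_Xelt (T : {linear QSym k -> QSym k}) f a b c :
  (forall F, coproduct (T F) = tensor_map T (coproduct F)) ->
  mcoeff (b ++ c) (T (Xelt f a)) =
  \sum_(j < (size a).+1)
    mcoeff b (T (Xelt f (take j a))) * mcoeff c (T (Xelt f (drop j a))).
Proof.
move=> T_coalg.
have TX d u : mcoeff d (T (Xelt f u)) = \sum_(bs <- cuts u)
    (\prod_(e <- bs) f e) * mcoeff d (T (QM (map cpart bs))).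
  rewrite XeltE linear_sum raddf_sum; apply: eq_bigr => bs _.
  by rewrite linearZ /= mcoeffZ.
pose t bs d := (\prod_(e <- bs) f e) * mcoeff d (T (QM (map cpart bs))).
transitivity (\sum_(bs <- cuts a) \sum_(i < (size bs).+1)
    t (take i bs) b * t (drop i bs) c).
  rewrite TX; apply: eq_bigr => bs _.
  rewrite -mcoeff_coproduct T_coalg /coproduct linextU size_map.
  rewrite /tensor_map linear_sum raddf_sum mulr_sumr; apply: eq_bigr => i _.
  rewrite tensorM /= linextU mcoeff_tensor mulrACA -!map_take -!map_drop.
  by rewrite -big_cat /= cat_take_drop.
rewrite (sum_cuts_split _ (fun bs cs => t bs b * t cs c)); apply: eq_bigr => j _.
by rewrite !TX mulr_suml; apply: eq_bigr => bs _; rewrite mulr_sumr.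
Qed.

Lemma tensor_map_id (E : QSym2 k) : tensor_map idfun E = E.
Proof.
apply/malgP => b; rewrite mcoeff_linext {3}(monalgE E) raddf_sum.
apply: eq_bigr => -[a a'] _ /=; rewrite tensorM !mcoeffU.
by rewrite mulr_natr.
Qed.

(** For nonempty [a], only the cut into a single block, of weight [f a], yields a monomial that
    [zetaQ] does not kill. *)
Lemma zetaQ_Xelt f a : f [::] = 1 -> zetaQ (Xelt f a) = f a.
Proof.
move=> f1; case: a => [|p a]; first by rewrite Xelt_nil zetaQM f1.
transitivity (linext (fun a => meval a [:: 1] : k^o) (Xelt f (p :: a))) => //.
rewrite functional_Xelt_cons big_ord_recr /= big1 => [|i _].
  rewrite add0r take_size drop_size big_seq1 big_nil mul1r.
  by rewrite -[X in _ * X]/(zetaQ _) zetaQM mulr1.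
rewrite big_seq big1 ?mulr0 // => bs.
rewrite mem_cuts => /andP[/eqP e _]; rewrite -[X in _ * X]/(zetaQ _) zetaQM.
case: bs e => [/esym/(congr1 size)|b bs]; last by rewrite mulr0.
by move/eqP; rewrite size_drop subn_eq0 leqNgt ltn_ord.
Qed.

(** * The character nu_Q on the X_a *)

Lemma nuQ_nil : nuQ (QM [::] : QSym k) = 1.
Proof. by rewrite /nuQ convM big_ord1 conv_inv0 zetaQM mulr1. Qed.

(** [zetaQ_bar] vanishes on lengths above one, so the recursion for its convolution inverse only
    ever strips the first part. The indicator comes from the split with empty first factor. *)
Lemma nuQ_cons p a :
  nuQ (QM (p :: a) : QSym k) =
  (a == [::])%:R - (-1) ^+ val p * nuQ (QM a : QSym k).
Proof.
rewrite /nuQ !convM big_ord_recl take0 drop0 conv_inv0 mul1r zetaQM /=.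
rewrite ltnS leqn0 size_eq0; congr (_ + _); rewrite mulr_sumr -sumrN.
apply: eq_bigr => i _; rewrite conv_inv_cons mulrA -mulNr; congr (_ * _).
rewrite big_ord_recl take0 drop0 big1 ?addr0 => [|j _].
  by rewrite zetaQ_barM zetaQM /= mulr1 /csize big_seq1.
rewrite zetaQ_barM zetaQM /= (size_takel (ltn_ord j)).
by rewrite mulr0 mul0r.
Qed.

(** Puts [nuQ] in the form [linext], which carries the linear structure. *)
Lemma nuQE : nuQ =1 linext (fun a => nuQ (QM a : QSym k) : k^o).
Proof. by apply: conv_ext => a; rewrite /nuQ convM. Qed.

(* This is [f^- * (nuQ o X) = f], solved for the term of the convolution in which
   the first factor is empty. *)
Lemma nuQ_Xelt_cons f p a :
  nuQ (Xelt f (p :: a)) = f (p :: a) -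
    \sum_(i < (size a).+1) (-1) ^+ csize (p :: take i a) * f (p :: take i a) *
      nuQ (Xelt f (drop i a)).
Proof.
have nuX u : nuQ (Xelt f u) =
    \sum_(bs <- cuts u) (\prod_(c <- bs) f c) * nuQ (QM (map cpart bs)).
  rewrite nuQE XeltE linear_sum; apply: eq_bigr => bs _.
  by rewrite linearZ nuQE.
have nilX u : \sum_(bs <- cuts u)
    (\prod_(c <- bs) f c) * (map cpart bs == [::])%:R = (u == [::])%:R.
  rewrite -(mcoeff_nil_Xelt f u) XeltE raddf_sum; apply: eq_bigr => bs _.
  by rewrite /= mcoeffZ mcoeff_QM.
rewrite nuQE functional_Xelt_cons /=.
under eq_bigr => i _ do (under eq_bigr => bs _ do
  rewrite -nuQE nuQ_cons val_cpart // mulrBr mulrCA).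
under eq_bigr => i _ do rewrite sumrB nilX -mulr_sumr -nuX mulrBr mulrCA mulrA.
(* The indicator survives only at [i = size a], where it contributes [f (p :: a)]. *)
rewrite sumrB big_ord_recr /= big1 => [|i _].
  by rewrite add0r take_size drop_size eqxx mulr1.
by rewrite -size_eq0 size_drop subn_eq0 leqNgt ltn_ord mulr0.
Qed.

(* The common value of [nu_Q(X_a)] and [c_a f(a)]. *)
Definition odd_exp a : k :=
  if all odd_part a then 2%:R ^+ size a * ((size a)`!%:R)^-1 else 0.

(** * Values of [f_of] and the exponential identity *)

(** A leading even part is absorbed into the function; this is why [conv_f_of] is stated for
    arbitrary [f]. *)
Lemma f_of_cons_even f p a : even_part p ->
  f_of f (p :: a) = f_of (fun u => f (p :: u)) a.
Proof.
rewrite /f_of /= => e; have -> : odd_part p = false by exact/negbTE.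
by rewrite e /= eqseq_cons eqxx.
Qed.

Lemma f_of_odd f a : all odd_part a -> f_of f a = f [::] * ((size a)`!%:R)^-1.
Proof.
move=> odd_a; rewrite /f_of (all_filterP odd_a).
have -> : filter even_part a = [::].
  by apply/eqP; rewrite -[_ == _]negbK -has_filter has_predC odd_a.
by rewrite eqxx; move: odd_a; rewrite all_count => /eqP ->.
Qed.

(** After an odd first part, any even part violates the even-before-odd order. *)
Lemma f_of_cons_odd f p a : odd_part p ->
  f_of f (p :: a) =
  if all odd_part a then f [::] * ((size a).+1`!%:R)^-1 else 0.
Proof.
move=> odd_p; case: ifP => odd_a; first by rewrite f_of_odd //= odd_p.
rewrite /f_of /= {1}/even_part -/(odd_part p) odd_p /=.
case E: (filter even_part a) => [|q u].
  move/negbT: odd_a; rewrite -has_predC has_filter.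
  by rewrite -[filter _ _]/(filter even_part a) E.
rewrite /= eqseq_cons; case: eqVneq => // epq.
have : q \in filter even_part a by rewrite E mem_head.
by rewrite mem_filter -epq /even_part -/(odd_part p) odd_p.
Qed.

Lemma odd_csize a : all odd_part a -> odd (csize a) = odd (size a).
Proof.
elim: a => [|p a IH] /=; first by rewrite /csize big_nil.
by case/andP=> odd_p /IH e; rewrite csize_cons oddD e -/(odd_part p) odd_p.
Qed.

Context (char0 : [pchar k] =i pred0).

Lemma fact_neq0 n : n`!%:R != 0 :> k.
Proof. by rewrite (proj1 (pcharf0P k) char0) -lt0n fact_gt0. Qed.

(** Coefficient comparison in exp(-x) exp(2x) = exp(x); multiplying by n!, nonzero in characteristic
    zero, gives the binomial theorem. *)
Lemma binomial_exp n :
  \sum_(i < n.+1) (-1) ^+ i * (i`!%:R)^-1 * (2%:R ^+ (n - i) * ((n - i)`!%:R)^-1) =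
  (n`!%:R)^-1 :> k.
Proof.
apply: (mulfI (fact_neq0 n)); rewrite divff ?fact_neq0 // mulr_sumr.
transitivity ((2%:R - 1) ^+ n : k); last by rewrite -addrA subrr addr0 expr1n.
rewrite exprDn; apply: eq_bigr => i _.
have le_in : (i <= n)%N by rewrite -ltnS.
rewrite -(bin_fact le_in) !natrM -[RHS]mulr_natl.
have := fact_neq0 i; have := fact_neq0 (n - i) => ni ii; by field; rewrite ni ii.
Qed.

(** Induction absorbs leading even parts into [f]. At the first odd part, either all remaining parts
    are odd and [binomial_exp] applies, or both sides vanish. *)
Lemma conv_f_of f a :
  \sum_(i < (size a).+1)
    (-1) ^+ csize (take i a) * f_of f (take i a) * odd_exp (drop i a) =
  f_of f a.
Proof.
have odd_case g u : all odd_part u -> \sum_(i < (size u).+1)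
    (-1) ^+ csize (take i u) * f_of g (take i u) * odd_exp (drop i u) = f_of g u.
  move=> odd_u; rewrite (f_of_odd _ _ odd_u) -binomial_exp mulr_sumr.
  apply: eq_bigr => i _; have le_i : (i <= size u)%N by rewrite -ltnS.
  move: (odd_u); rewrite -{1}(cat_take_drop i u) all_cat => /andP[ot od].
  rewrite f_of_odd // /odd_exp od size_drop -signr_odd odd_csize //.
  by rewrite size_takel // signr_odd !mulrA [_ * g _]mulrC.
elim: a f => [|p a IH] f; first exact: odd_case.
have [odd_p|even_p] := boolP (odd_part p).
  have [odd_pa|] := boolP (all odd_part (p :: a)); first exact: odd_case.
  rewrite /= odd_p f_of_cons_odd //= => /negbTE odd_a; rewrite odd_a.
  (* An even part of [a] lies either in the prefix, where [f_of] vanishes because of the leading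
     [p], or in the suffix, where [odd_exp] vanishes. *)
  apply: big1 => -[[|i] lt_i] _; rewrite /= /odd_exp.
    by rewrite /= odd_a andbF mulr0.
  rewrite f_of_cons_odd //; case: ifP => ot; last by rewrite mulr0 mul0r.
  case: ifP => od; last by rewrite mulr0.
  by rewrite -(cat_take_drop i a) all_cat ot od in odd_a.
rewrite big_ord_recl /= /odd_exp /= (negbTE even_p) mulr0 add0r.
rewrite f_of_cons_even // -IH.
apply: eq_bigr => i _ /=; rewrite f_of_cons_even // csize_cons exprD.
by rewrite -[(-1) ^+ val p]signr_odd -/(odd_part p) (negbTE even_p) mul1r.
Qed.

Lemma f_of_nil f : f_of f [::] = f [::].
Proof. by rewrite f_of_odd // fact0 invr1 mulr1. Qed.

(** By [nuQ_Xelt_cons] and [conv_f_of], both sides obey the same recursion, which determines the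
    value at [a] from its proper suffixes. *)
Lemma nuQ_Xelt f a : f [::] = 1 -> nuQ (Xelt (f_of f) a) = odd_exp a.
Proof.
move=> f1; have [n] := ubnP (size a); elim: n a => // n IH [|p a] /= lt_an.
  by rewrite Xelt_nil nuQ_nil /odd_exp /= mul1r fact0 invr1.
rewrite nuQ_Xelt_cons -(conv_f_of f (p :: a)) big_ord_recl take0 drop0.
rewrite f_of_nil f1 mulr1 {1}/csize big_nil mul1r -addrA -sumrB.
rewrite big1 ?addr0 // => i _.
by rewrite IH ?subrr // size_drop (leq_ltn_trans (leq_subr _ _)).
Qed.

(** * The eigenvalue equation *)

Definition eigenvalue a : k := if all odd_part a then 2%:R ^+ size a else 0.

Lemma eigenvalue_cat a b : eigenvalue (a ++ b) = eigenvalue a * eigenvalue b.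
Proof.
rewrite /eigenvalue all_cat size_cat exprD.
by case: all; case: all; rewrite ?mulr0 ?mul0r.
Qed.

Lemma hopf_Xelt (Theta : {linear QSym k -> QSym k}) f a :
  hopf_map Theta -> (forall F, zetaQ (Theta F) = nuQ F) -> f [::] = 1 ->
  Theta (Xelt (f_of f) a) = eigenvalue a *: Xelt (f_of f) a.
Proof.
case=> _ _ Theta_counit Theta_coalg Theta_homog Theta_zeta f1.
apply/malgP => b; rewrite mcoeffZ; elim: b a => [|p b IH] a.
  rewrite -[LHS]/(counit _) Theta_counit /counit mcoeff_nil_Xelt.
  by case: a => [|p a]; rewrite /= ?mulr0 // /eigenvalue mul1r.
rewrite -cat1s (mcoeff_cat_Xelt Theta) //.
have := mcoeff_cat_Xelt idfun (f_of f) a [:: p] b.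
rewrite /= => ->; last by move=> F; rewrite tensor_map_id.
rewrite mulr_sumr; apply: eq_bigr => i _; rewrite IH.
have -> : eigenvalue a = eigenvalue (take i a) * eigenvalue (drop i a).
  by rewrite -eigenvalue_cat cat_take_drop.
rewrite mulrACA; congr (_ * _).
(* Both elements are homogeneous of degree [csize (take i a)], so their coefficients at [[:: p]] are
   values of [zetaQ], or zero when the degrees differ. *)
rewrite (mcoeff_homogeneous _ _ p (homogeneous_Xelt _ _)).
rewrite (mcoeff_homogeneous _ _ p (Theta_homog _ _ (homogeneous_Xelt _ _))).
case: eqP => _; last by rewrite mulr0.
rewrite Theta_zeta nuQ_Xelt // zetaQ_Xelt ?f_of_nil // /odd_exp /eigenvalue.
by case: ifP => [odd_u|]; rewrite ?mul0r // f_of_odd // f1 mul1r.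
Qed.

(** * Triangularity and the basis property *)

Lemma Xelt_triangular f a : exists2 r : seq (k * composition),
  Xelt f a = (\prod_(p <- a) f [:: p]) *: QM a +
             \sum_(cb <- r) cb.1 *: QM cb.2 &
  forall cb, cb \in r -> (size cb.2 < size a)%N.
Proof.
have [r e lt] := cuts_singletons a.
exists [seq (\prod_(c <- bs) f c, map cpart bs) | bs <- r].
  by rewrite XeltE e big_cons map_cpart_singletons !big_map.
by move=> _ /mapP[bs bs_in ->]; rewrite size_map lt.
Qed.

Lemma Xelt_basis f : (forall p, f [:: p] != 0) -> is_basis (Xelt f).
Proof.
move=> f_neq0.
have diag_neq0 a : \prod_(p <- a) f [:: p] != 0.
  by rewrite prodf_seq_neq0; apply/allP => p _; rewrite f_neq0.
have span_QM a : exists c, QM a = linext (Xelt f) c.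
  have [n] := ubnP (size a); elim: n a => // n IH a lt_an.
  have [r e lt] := Xelt_triangular f a.
  (* Once the shorter terms are expressed through [c], the triangular relation is solved for
     [QM a]. *)
  suff [c ec] : exists c, \sum_(cb <- r) cb.1 *: QM cb.2 = linext (Xelt f) c.
    exists ((\prod_(p <- a) f [:: p])^-1 *: (mkmalgU a 1 - c)).
    rewrite linearZ linearB /= linextU -ec e addrK scalerA mulVf ?scale1r //.
  elim: r lt {e} => [|[x b] r IHr] lt.
    by exists 0; rewrite big_nil linear0.
  case: IHr => [cb cb_in|c ec]; first by rewrite lt // inE cb_in orbT.
  have [|d ed] := IH b.
    by apply: leq_trans (lt (x, b) _) _ => //; rewrite mem_head.
  by exists (x *: d + c); rewrite big_cons ec ed linearD linearZ.
have inj c : linext (Xelt f) c = 0 -> c = 0.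
  (* Coefficients vanish beyond the maximal length [N]; induction on [n] carries this down to
     shorter compositions, and [n = N.+1] covers all of them. *)
  move=> c0; pose N := (\max_(a <- msupp c) size a)%N.
  suff coef0 n a : (N < size a + n)%N -> mcoeff a c = 0.
    by apply/malgP => a; rewrite mcoeff0 (coef0 N.+1) // addnS ltnS leq_addl.
  elim: n a => [|n IH] a.
    rewrite addn0 ltnNge => /negP lt_a; apply/mcoeff_outdom/negP => a_in.
    by apply: lt_a; rewrite /N (big_rem a) //= leq_maxl.
  move=> lt_a; have := congr1 (mcoeff a) c0.
  (* Longer [b] drop out by induction; for the others, the lower terms of X_b are shorter than [a],
     so only the leading term of [b = a] counts. *)
  have Xa b : mcoeff b c * mcoeff a (Xelt f b) =
      if b == a then mcoeff a c * \prod_(p <- a) f [:: p] else 0.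
    have [r e lt] := Xelt_triangular f b.
    have low : (size b <= size a)%N ->
        mcoeff a (\sum_(cb <- r) cb.1 *: QM cb.2) = 0.
      move=> le_ba; rewrite raddf_sum.
      apply: big1_seq => -[x d] /andP[_ /lt lt_d] /=.
      rewrite mcoeffZ mcoeff_QM; case: eqP => [ed|]; last by rewrite mulr0.
      by rewrite ed ltnNge le_ba in lt_d.
    case: (leqP (size b) (size a)) => [le_ba|lt_ab].
      rewrite e mcoeffD low // addr0 mcoeffZ mcoeff_QM.
      by case: eqVneq => [->|_]; rewrite ?mulr1 ?mulr0.
    rewrite IH; last by rewrite (leq_trans lt_a) // addnS ltn_add2r.
    by rewrite mul0r; case: eqVneq => // eba; rewrite eba ltnn in lt_ab.
  rewrite mcoeff_linext mcoeff0; under eq_bigr do rewrite Xa.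
  have [a_in|/mcoeff_outdom //] := boolP (a \in msupp c).
  rewrite (big_fsetD1 _ a_in) /= eqxx [X in _ + X]big1_seq ?addr0.
    by move/eqP; rewrite mulf_eq0 (negbTE (diag_neq0 a)) orbF => /eqP.
  by move=> b; rewrite !inE => /andP[_ /andP[/negbTE ->]].
move=> F; have [c ec] : exists c, F = linext (Xelt f) c.
  rewrite -(linext_QM F) {1}/linext; elim: (msupp F : seq _) => [|a s [c ec]].
    by exists 0; rewrite big_nil linear0.
  have [d ed] := span_QM a; exists (mcoeff a F *: d + c).
  by rewrite big_cons ec ed linearD linearZ.
exists c; split => // d ed; apply/esym/subr0_eq/inj.
by rewrite linearB /= -ec -ed subrr.
Qed.

End Coalgebra.

Theorem theorem6p1 (k : fieldType) (char0 : [pchar k] =i pred0)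
    (fE : composition -> k)
    (fE_char : nonsingular_shuffle_character even_part fE)
    (Theta : {linear QSym k -> QSym k})
    (Theta_hopf : hopf_map Theta)
    (Theta_zeta : forall F : QSym k, zetaQ (Theta F) = nuQ F) :
  is_eigenbasis Theta (Xelt (f_of fE)) /\
  (forall a : composition,
     Theta (Xelt (f_of fE) a) =
       if all odd_part a then 2%:R ^+ size a *: Xelt (f_of fE) a else 0).
Proof.
have [fE1 fE_neq0 _] := fE_char.
have eigen a := hopf_Xelt char0 Theta fE a Theta_hopf Theta_zeta fE1.
split; last by move=> a; rewrite eigen /eigenvalue; case: ifP; rewrite ?scale0r.
split; last by move=> a; exists (eigenvalue a); apply: eigen.
(* On one part, [f_of] is 1/1! if the part is odd and a value of [fE], nonzero by nonsingularity, if
   it is even. *)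
apply: Xelt_basis => p; have [odd_p|even_p] := boolP (odd_part p).
  by rewrite f_of_odd /= ?odd_p // fE1 mul1r invr_neq0 // fact_neq0.
by rewrite f_of_cons_even // f_of_nil fE_neq0.
Qed.
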